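(* Let $n \geq 2$ be an integer and let $q \geq 3$ be a prime power. Let $G_{\mathrm{pr}}(\mathbb{F}_q^n)$ be the phase-rotation distance graph, and let $\alpha_2$ denote the $2$-independence number. Then \[ \alpha_2(G_{\mathrm{pr}}(\mathbb{F}_q^n)) \leq q^{n-2}\, \frac{n(n+1)+\lfloor \tfrac{n}{q} \rfloor q \big( -2-2n+q+ \lfloor \tfrac{n}{q} \rfloor q \big) }{ \big( n- \lfloor \tfrac{n}{q} \rfloor \big) \big( n+1-\lfloor \tfrac{n}{q} \rfloor \big)}. \]
   Context: Let $\mathbf{e}_1,\ldots,\mathbf{e}_n$ be the standard basis of $\mathbb{F}_q^n$ and $\mathbf{1}$ the all-ones vector. Put $F_i=\mathrm{span}(\mathbf{e}_i)$ for $i=1,\ldots,n$ and $F_{n+1}=\mathrm{span}(\mathbf{1})$. The phase-rotation weight of $\mathbf{x}\in\mathbb{F}_q^n$ is $w_{\mathrm{pr}}(\mathbf{x})=\min\{|I| : I\subseteq\{1,\ldots,n+1\},\ \mathbf{x}\in\mathrm{span}(\bigcup_{i\in I}F_i)\}$, and the phase-rotation distance is $d_{\mathrm{pr}}(\mathbf{x},\mathbf{y})=w_{\mathrm{pr}}(\mathbf{x}-\mathbf{y})$. The phase-rotation distance graph $G_{\mathrm{pr}}(\mathbb{F}_q^n)$ is the graph with vertex set $\mathbb{F}_q^n$ in which $\mathbf{x},\mathbf{y}$ are adjacent if and only if $d_{\mathrm{pr}}(\mathbf{x},\mathbf{y})=1$. For a graph $G$, the $k$-independence number $\alpha_k(G)$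 is the size of the largest set of vertices such that any two distinct vertices in the set are at geodesic distance greater than $k$ in $G$. *)

(* Defs.v *)
From mathcomp Require Import all_boot all_order all_algebra.

Set Implicit Arguments.
Unset Strict Implicit.
Unset Printing Implicit Defensive.

Import GRing.Theory.
Local Open Scope ring_scope.

Section GraphDistance.
Variables (T : finType) (e : rel T).

Definition walk (d : nat) (x y : T) : bool :=
  [exists p : d.-tuple T, path e x p && (last x p == y)].

Lemma walkP d x y :
  reflect (exists p, [/\ path e x p, last x p = y & size p = d]) (walk d x y).
Proof.
apply: (iffP existsP) => [[p /andP[ep /eqP lp]]|[p [ep lp /eqP sp]]].
  by exists p; rewrite size_tuple.
by exists (Tuple sp); rewrite /= ep lp eqxx.
Qed.

Lemma connect_walk x y : connect e x y -> exists d, walk d x y.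
Proof.
by case/connectP=> p ep ->; exists (size p); apply/walkP; exists p.
Qed.

(* [None] is the infinite distance between distinct connected components. *)
Definition geodist (x y : T) : option nat :=
  if @idP (connect e x y) is ReflectT exy then Some (ex_minn (connect_walk exy))
  else None.

Definition geodist_gt (k : nat) (x y : T) : bool :=
  if geodist x y is Some d then (k < d)%N else true.

Lemma geodist_gtP k x y :
  reflect (forall p, path e x p -> last x p = y -> (k < size p)%N)
          (geodist_gt k x y).
Proof.
rewrite /geodist_gt /geodist; case: {-}_ / idP => [exy | nexy].
  case: ex_minnP => d walk_d min_d; apply: (iffP idP) => [kd p ep lp | lt_k].
    by apply: leq_trans kd (min_d _ _); apply/walkP; exists p.
  by have /walkP[p [ep lp <-]] := walk_d; apply: lt_k.
by apply: ReflectT => p ep lp; case: nexy; apply/connectP; exists p.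
Qed.

Definition kindependent (k : nat) (S : {set T}) : bool :=
  [forall x in S, forall y in S, (x != y) ==> geodist_gt k x y].

Definition kindep_number (k : nat) : nat :=
  \max_(S : {set T} | kindependent k S) #|S|.

End GraphDistance.

Section PhaseRotation.
Variables (F : finFieldType) (n : nat).
Implicit Types (x y : 'rV[F]_n) (I : {set 'I_n.+1}).

(* Indices are shifted to start at 0, so the last one, [ord_max], is the
   index of the line spanned by the all-ones vector. *)
Definition pr_line (i : 'I_n.+1) : {vspace 'rV[F]_n} :=
  if unlift ord_max i is Some j then <[(delta_mx 0 j)%R]>%VS
  else <[const_mx 1%R]>%VS.

(* The span of a union of subspaces is their sum. *)
Definition pr_span I : {vspace 'rV[F]_n} := (\sum_(i in I) pr_line i)%VS.

Lemma pr_spanT x : x \in pr_span setT.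
Proof.
rewrite [x]row_sum_delta; apply: memv_suml => j _; apply: memvZ.
have /subvP : (pr_line (lift ord_max j) <= pr_span setT)%VS.
  exact: (sumv_sup (lift ord_max j)).
by apply; rewrite /pr_line liftK memv_line.
Qed.

(* By [pr_spanT] the default value [setT] belongs to the family minimised
   over. *)
Definition pr_weight x : nat :=
  #|[arg min_(I < [set: 'I_n.+1] | x \in pr_span I) #|I|]|.

Definition pr_dist x y : nat := pr_weight (x - y).

Definition pr_graph : rel 'rV[F]_n := fun x y => pr_dist x y == 1%N.

Lemma pr_weightP x :
  (exists2 I, x \in pr_span I & #|I| = pr_weight x) /\
  (forall I, x \in pr_span I -> (pr_weight x <= #|I|)%N).
Proof.
rewrite /pr_weight; case: arg_minnP => [|I xI minI]; first exact: pr_spanT.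
by split; first exists I.
Qed.

Lemma pr_weightN x : pr_weight (- x) = pr_weight x.
Proof.
have [[I xI <-] minI] := pr_weightP x; have [[J xJ <-] minJ] := pr_weightP (- x).
by apply/eqP; rewrite eqn_leq minJ ?rpredN // minI // -rpredN.
Qed.

Lemma pr_graph_sym : symmetric pr_graph.
Proof. by move=> x y; rewrite /pr_graph /pr_dist -pr_weightN opprB. Qed.

Lemma pr_graph_irr : irreflexive pr_graph.
Proof.
move=> x; rewrite /pr_graph /pr_dist subrr.
have [_ /(_ set0)] := pr_weightP 0.
by rewrite mem0v cards0 leqn0 => /(_ isT)/eqP->.
Qed.

End PhaseRotation.

(* Main.v *)
(* A ratio-type bound, with projections in place of characters. Averaging over
   the cosets of a subspace U is an orthogonal projection P_U of the functions
   on F^n, and P_U P_W = P_(U + W). Let T be the sum of the projections P_i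
   along the n + 1 lines, so that the adjacency matrix is q T - (n + 1). The
   P_i commute, hence T has eigenvalues k in {0, ..., n + 1}, where n + 1 belongs
   to P_(F^n), the projection onto the constants. As (k - t) (k - t - 1) >= 0
   for integers k and t, the matrix
     (T - t) (T - t - 1) - (n + 1 - t) (n - t) P_(F^n)
   is positive semidefinite. Evaluate it at the indicator of a 2-independent
   set S: distinct points of S never differ by an element of a sum of two
   lines, so P_i, P_i P_j and P_(F^n) contribute |S| / q, |S| / q^2 and
   |S|^2 / q^n. The choice t = n %/ q gives the bound. *)

Require Import Defs.
From mathcomp Require Import all_boot all_order all_algebra finfield.
From mathcomp Require Import ring lra zify.

Set Implicit Arguments.
Unset Strict Implicit.
Unset Printing Implicit Defensive.

Import Order.TTheory GRing.Theory Num.Theory.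
Local Open Scope ring_scope.

(** * Ring identities for an idempotent commuting with another element *)

Section Idempotents.
Variable A : pzRingType.
Implicit Types P X Y : A.

Lemma idem_compl P : P * P = P -> (1 - P) * (1 - P) = 1 - P.
Proof. by move=> PP; rewrite mulrBr mulr1 mulrBl mul1r PP subrr subr0. Qed.

Lemma comm_compl P Y : GRing.comm P Y -> GRing.comm (1 - P) Y.
Proof.
by move=> PY; apply/commr_sym/commrB; [exact: commr1 | exact: commr_sym].
Qed.

Lemma idem_sandwich P Y :
  P * P = P -> GRing.comm P Y -> P * Y * P = P * Y.
Proof. by move=> PP PY; rewrite PY -mulrA PP. Qed.

(* [P + X] acts as [X + 1] on the image of [P] and as [X] on its kernel. *)
Lemma split_idem P X :
    P * P = P -> GRing.comm P X ->
  (P + X) * (P + X - 1) =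
    P * ((X + 1) * X) * P + (1 - P) * (X * (X - 1)) * (1 - P).
Proof.
move=> PP PX.
rewrite !idem_sandwich ?idem_compl //; first last.
- by apply: commrM => //; apply: commrD => //; apply: commr1.
- by apply: comm_compl; apply: commrM => //; apply: commrB => //; apply: commr1.
have -> : P * ((X + 1) * X) + (1 - P) * (X * (X - 1)) = X * (X - 1) + P * (X + X).
  rewrite mulrBl mul1r addrCA -mulrBr; congr (_ + P * _).
  by rewrite mulrDl mulrBr mul1r mulr1 opprB [X * X + X]addrC addrACA subrr addr0.
rewrite -addrA mulrDr !mulrDl PP mulrDr -PX mulrBr mulr1.
rewrite mulrN1 addrA addrC; congr (_ + _).
by rewrite addrC addrA subrK mulrDr.
Qed.

Lemma mulr_shift2 X (t : nat) :
  (X - t%:R) * (X - t%:R - 1) = X * X - X *+ (2 * t + 1) + (t * (t + 1))%:R.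
Proof.
rewrite -addrA -opprD natr1 mulrBl !mulrBr mulr_natr mulr_natl -natrM opprB.
rewrite addrA addrAC -2!addrA.
rewrite [_ + (_ + _%:R)]addrA -opprD -mulrnDr addrA.
by congr (_ - _ *+ _ + _%:R); lia.
Qed.

End Idempotents.

(** * Quadratic forms and positive semidefinite matrices *)

Section PositiveSemidefinite.
Variables (R : realDomainType) (N : nat).
Implicit Types (M P : 'M[R]_N) (u : 'rV[R]_N).

Definition quad u M : R := (u *m M *m u^T) 0 0.

Lemma quadD u M1 M2 : quad u (M1 + M2) = quad u M1 + quad u M2.
Proof. by rewrite /quad mulmxDr mulmxDl mxE. Qed.

Lemma quadZ u a M : quad u (a *: M) = a * quad u M.
Proof. by rewrite /quad -scalemxAr -scalemxAl mxE. Qed.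

Lemma quadN u M : quad u (- M) = - quad u M.
Proof. by rewrite -scaleN1r quadZ mulN1r. Qed.

Lemma quad_sum u I (r : seq I) (M : I -> 'M[R]_N) :
  quad u (\sum_(i <- r) M i) = \sum_(i <- r) quad u (M i).
Proof. by rewrite /quad mulmx_sumr mulmx_suml summxE. Qed.

Lemma quadMn u M k : quad u (M *+ k) = quad u M *+ k.
Proof. by rewrite -scaler_nat quadZ mulr_natl. Qed.

Definition psd M := forall u, 0 <= quad u M.

Lemma psd0 : psd 0.
Proof. by move=> u; rewrite /quad mulmx0 mul0mx mxE. Qed.

Lemma psdD M1 M2 : psd M1 -> psd M2 -> psd (M1 + M2).
Proof. by move=> M1_ge0 M2_ge0 u; rewrite quadD addr_ge0. Qed.

Lemma psdZ a M : 0 <= a -> psd M -> psd (a *: M).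
Proof. by move=> a_ge0 M_ge0 u; rewrite quadZ mulr_ge0. Qed.

Lemma psd_congr P M : P^T = P -> psd M -> psd (P * M * P).
Proof.
move=> trP M_ge0 u; have := M_ge0 (u *m P).
by rewrite /quad trmx_mul trP !mulmxA.
Qed.

Lemma psd1 : psd 1.
Proof.
move=> u; rewrite /quad mulmx1 mxE sumr_ge0 // => i _.
by rewrite mxE -expr2 sqr_ge0.
Qed.

Lemma psd_proj P : P^T = P -> P * P = P -> psd P.
Proof.
by move=> trP PP; have := psd_congr trP psd1; rewrite mulr1 PP.
Qed.

End PositiveSemidefinite.

(** * Averaging projections over cosets and the operator inequality *)

Section Averaging.
Variables (F : finFieldType) (n : nat).
Local Notation V := ('rV[F]_n).
Local Notation N := #|{: V}|.
Implicit Types (U W : {vspace V}) (S : {set V}).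

(** The ways of writing [x] as a vector of [U] plus a vector of [W] form a coset of [U :&: W], if
    there are any. *)
Lemma card_fiber U W (x : V) :
  #|[pred c | (c \in U) && (x - c \in W)]| = ((x \in U + W)%VS * #|(U :&: W)%VS|)%N.
Proof.
have [/memv_addP[u uU [w wW ->]] | xUW] := boolP (x \in (U + W)%VS); last first.
  rewrite mul0n; apply: eq_card0 => c; rewrite inE; apply: contraNF xUW.
  by case/andP=> cU xcW; rewrite -[x](subrK c) addrC memv_add.
rewrite mul1n -[RHS](card_image (addrI u)); apply: eq_card => c.
rewrite inE; apply/andP/imageP=> [[cU ucW] | [v]].
  exists (c - u); last by rewrite addrC subrK.
  by rewrite memv_cap rpredB //= -opprB rpredN -(rpredDr _ wW) addrAC.
rewrite memv_cap => /andP[vU vW] ->; split; first exact: rpredD.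
by rewrite opprD addrA [u + w]addrC addrK rpredB.
Qed.

(** The orthogonal projection onto the functions constant on cosets of [U]; [enum_val] turns matrix
    indices into vectors. *)
Definition avg_mx U : 'M[rat]_N :=
  \matrix_(a, b) ((enum_val a - enum_val b \in U)%:R / #|U|%:R).

Lemma card_vs_neq0 U : #|U|%:R != 0 :> rat.
Proof. by rewrite pnatr_eq0 -lt0n; apply/card_gt0P; exists 0; rewrite mem0v. Qed.

Lemma tr_avg_mx U : (avg_mx U)^T = avg_mx U.
Proof. by apply/matrixP=> a b; rewrite !mxE -rpredN opprB. Qed.

Lemma avg_mxM U W : avg_mx U * avg_mx W = avg_mx (U + W)%VS.
Proof.
apply/matrixP=> a b; rewrite !mxE; set x := enum_val a; set y := enum_val b.
transitivity (\sum_(c in {: V})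
    (x - c \in U)%:R / #|U|%:R * ((c - y \in W)%:R / #|W|%:R) : rat).
  by rewrite [RHS]big_enum_val; apply: eq_bigr => c _; rewrite !mxE.
(* Substituting [x - c] for [c] turns the entry of the product into the count of [card_fiber] at
   [x - y]. *)
have opp_add_inj : injective (fun c => x - c) by move=> c d /addrI/oppr_inj.
rewrite (reindex_inj opp_add_inj) /=.
under eq_bigr => c _.
  rewrite opprB addrC subrK addrAC mulrACA -natrM mulnb -invfM -natrM; over.
rewrite -mulr_suml -natr_sum -big_mkcond sum1_card card_fiber natrM.
have -> : (#|U| * #|W| = #|(U + W)%VS| * #|(U :&: W)%VS|)%N.
  by rewrite !card_vspace -!expnD dimv_sum_cap.
by rewrite natrM invfM mulrACA mulfV ?mulr1 ?card_vs_neq0.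
Qed.

Lemma avg_mx0 : avg_mx 0 = 1.
Proof.
apply/matrixP=> a b; rewrite !mxE memv0 subr_eq0 (inj_eq enum_val_inj).
by rewrite card_vspace dimv0 divr1.
Qed.

Lemma avg_mx_idem U : avg_mx U * avg_mx U = avg_mx U.
Proof. by rewrite avg_mxM addvv. Qed.

Lemma comm_avg_mx U W : GRing.comm (avg_mx U) (avg_mx W).
Proof. by rewrite /GRing.comm !avg_mxM addvC. Qed.

Lemma tr_compl_avg_mx U : (1 - avg_mx U)^T = 1 - avg_mx U.
Proof. by rewrite linearB /= tr_avg_mx tr_scalar_mx. Qed.

Lemma psd_avg_mx U : psd (avg_mx U).
Proof. exact: psd_proj (tr_avg_mx U) (avg_mx_idem U). Qed.

(** As the two projections commute, the product is the second one sandwiched between two copies of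
    the first. *)
Lemma psd_compl_avg_mx U W : psd ((1 - avg_mx U) * avg_mx W).
Proof.
have := psd_congr (tr_compl_avg_mx U) (psd_avg_mx W); congr psd.
exact: idem_sandwich (idem_compl (avg_mx_idem U)) (comm_compl (comm_avg_mx U W)).
Qed.

Definition sum_avg (s : seq {vspace V}) := \sum_(U <- s) avg_mx U.

Lemma comm_sum_avg U s : GRing.comm (avg_mx U) (sum_avg s).
Proof. by apply: commr_sum => W _; apply: comm_avg_mx. Qed.

(** Induction on [s], splitting along the projection [P] of the head: on the image of [P] the sum
    gains 1, so the hypothesis is used at [t - 1]; on the kernel it is used at [t]. Since [t]
    decreases, it ranges over the integers. *)
Lemma psd_sum_avg s (t : int) :
  let X := sum_avg s - t%:~R in
  let d := (size s)%:Z - t in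
  psd (X * (X - 1) - (d * (d - 1))%:~R *: avg_mx (\sum_(U <- s) U)%VS).
Proof.
elim: s t => [|U s IHs] t X d.
  rewrite /X /d /sum_avg !big_nil avg_mx0 !sub0r -mulrNz scaler_int.
  by rewrite -[X in _ * (_ - X)]/(1%:~R) -mulrzBr -intrM subrr; apply: psd0.
set P := avg_mx U; set Y := sum_avg s - t%:~R.
set e : int := (size s)%:Z - t; set W := (\sum_(U <- s) U)%VS.
have dE : d = e + 1 by rewrite /d /e /= intS; ring.
have XE : X = P + Y by rewrite /X /Y /sum_avg big_cons addrA.
have PP : P * P = P := avg_mx_idem U.
have PY : GRing.comm P Y.
  by apply: commrB; [apply: comm_sum_avg | apply: commr_int].
have PK : GRing.comm P (avg_mx W) := comm_avg_mx U W.
have CC := idem_compl PP; have CK := comm_compl PK.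
have IH0 := psd_congr (tr_compl_avg_mx U) (IHs t).
have := psd_congr (tr_avg_mx U) (IHs (t - 1)).
have -> : sum_avg s - (t - 1)%:~R = Y + 1 by rewrite mulrzBr opprB addrCA addrC.
have -> : (size s)%:Z - (t - 1) = d by rewrite dE /e; ring.
rewrite addrK => IH1.
(* Integrality enters here: a product of two consecutive integers is nonnegative. So the term that
   [IH0] subtracts on the kernel of [P] can be added back, while the term from [IH1] becomes the
   projection for [U + W]. *)
have e_ge0 : 0 <= (e * (e - 1))%:~R :> rat.
  by rewrite ler0z; have : e <= 0 \/ 1 <= e; [lia | case=> ?; nia].
have := psdD (psdD IH1 IH0) (psdZ e_ge0 (psd_compl_avg_mx U W)).
congr psd.
have sandwichB (C M : 'M[rat]_N) a : C * C = C -> GRing.comm C (avg_mx W) ->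
    C * (M - a *: avg_mx W) * C = C * M * C - a *: (C * avg_mx W).
  move=> CC' CK'; rewrite mulrBr mulrBl.
  have -> : C * (a *: avg_mx W) = a *: (C * avg_mx W) by exact/esym/scalemxAr.
  have -> : a *: (C * avg_mx W) * C = a *: (C * avg_mx W * C) by exact/esym/scalemxAl.
  by rewrite (idem_sandwich CC' CK').
rewrite -/Y -/e -/P -/W XE (split_idem PP PY) !sandwichB //.
by rewrite big_cons -avg_mxM -/P -/W -addrA subrK addrAC.
Qed.

Definition indicator S : 'rV[rat]_N := \row_a (enum_val a \in S)%:R.

Lemma quad_avg_mx S U :
  quad (indicator S) (avg_mx U) =
    \sum_(x in S) \sum_(y in S) (x - y \in U)%:R / #|U|%:R.
Proof.
transitivity (\sum_(y in {: V}) \sum_(x in {: V})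
    (x \in S)%:R * ((x - y \in U)%:R / #|U|%:R) * (y \in S)%:R : rat).
  rewrite [RHS]big_enum_val /quad mxE; apply: eq_bigr => b _.
  rewrite [in RHS]big_enum_val !mxE mulr_suml; apply: eq_bigr => a _.
  by rewrite !mxE.
rewrite exchange_big [RHS]big_mkcond /=; apply: eq_bigr => x _.
case: (x \in S); last by rewrite big1 // => y _; rewrite !mul0r.
rewrite [RHS]big_mkcond; apply: eq_bigr => y _.
by case: (y \in S); rewrite ?mulr0 // mulr1 mul1r.
Qed.

Lemma quad_avg_fullv S :
  quad (indicator S) (avg_mx fullv) = #|S|%:R ^+ 2 / #|F|%:R ^+ n.
Proof.
rewrite quad_avg_mx; under eq_bigr do under eq_bigr do rewrite memvf mul1r.
rewrite !sumr_const card_vspacef card_mx mul1n natrX.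
by rewrite -mulrnA -[LHS]mulr_natl natrM.
Qed.

(** Only the pairs [x = y] contribute to the double sum. *)
Lemma quad_avg_separated S U :
    {in S &, forall x y, x - y \in U -> x = y} ->
  quad (indicator S) (avg_mx U) = #|S|%:R / #|U|%:R.
Proof.
move=> sepS; rewrite quad_avg_mx -[in RHS]sum1_card natr_sum mulr_suml.
apply: eq_bigr => x xS; rewrite (bigD1 x) //= subrr mem0v big1 ?addr0 //.
move=> y /andP[yS y'x]; case: (boolP (_ \in U)) => [xyU | _]; last exact: mul0r.
by rewrite (sepS x y) ?eqxx in y'x.
Qed.

End Averaging.

(** * The lines of the phase-rotation metric and 2-independent sets *)

Section PhaseRotationLines.
Variables (F : finFieldType) (n : nat).
Local Notation V := ('rV[F]_n).
Implicit Types (x y : V) (i j : 'I_n.+1).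

Lemma pr_graph_line i x y : x - y \in pr_line F i -> x != y -> pr_graph x y.
Proof.
move=> xy_i; rewrite -subr_eq0 => xy_neq0; rewrite /pr_graph /pr_dist eqn_leq.
have [[I xyI <-] minI] := pr_weightP (x - y).
apply/andP; split.
  by rewrite -(cards1 i); apply: minI; rewrite /pr_span big_set1.
rewrite card_gt0; apply: contraNneq xy_neq0 => I0.
by move: xyI; rewrite I0 /pr_span big_set0 memv0.
Qed.

(** If [x - y = u + w] with [u], [w] on the two lines, then [x], [x - u], [y] is a walk of length at
    most 2. *)
Lemma kindep2_separated (S : {set V}) i j :
    kindependent (@pr_graph F n) 2 S ->
  {in S &, forall x y, x - y \in (pr_line F i + pr_line F j)%VS -> x = y}.
Proof.
move=> /forall_inP indepS x y xS yS /memv_addP[u ui [w wj xyE]].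
apply: contraTeq isT => xy_neq.
have /forall_inP/(_ y yS)/implyP/(_ xy_neq)/geodist_gtP := indepS x xS.
have ui' : x - (x - u) \in pr_line F i by rewrite subKr.
have wj' : x - u - y \in pr_line F j by rewrite addrAC xyE addrAC subrr add0r.
(* The graph has no loops, so a step by a zero vector has to be dropped from the walk. *)
have [xu | xu_neq] := eqVneq x (x - u).
  rewrite -xu in wj'; move/(_ [:: y]) => /=.
  by rewrite (pr_graph_line wj') // => /(_ isT erefl).
have [uy | uy_neq] := eqVneq (x - u) y.
  by move/(_ [:: y])=> /=; rewrite -{1}uy (pr_graph_line ui') // => /(_ isT erefl).
move/(_ [:: x - u; y]) => /=.
by rewrite (pr_graph_line ui') ?(pr_graph_line wj') // => /(_ isT erefl).
Qed.

Definition pr_vec (i : 'I_n.+1) : V :=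
  if unlift ord_max i is Some j then delta_mx 0 j else const_mx 1.

Lemma pr_lineE i : pr_line F i = <[pr_vec i]>%VS.
Proof. by rewrite /pr_line /pr_vec; case: unliftP. Qed.

Lemma pr_vec_neq0 i : (0 < n)%N -> pr_vec i != 0.
Proof.
move=> n_gt0; rewrite /pr_vec; case: unliftP => [j _ | _].
  by apply/eqP=> /rowP/(_ j)/eqP; rewrite !mxE !eqxx oner_eq0.
by apply/eqP=> /rowP/(_ (Ordinal n_gt0))/eqP; rewrite !mxE oner_eq0.
Qed.

Lemma pr_line_disjoint i j :
  (1 < n)%N -> i != j -> (pr_line F i :&: pr_line F j)%VS = 0%VS.
Proof.
move=> n_gt1; wlog [k ->] : i j / exists k, i = lift ord_max k.
  move=> IH ij; case: (unliftP ord_max i) => [k ik | i_max].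
    by apply: IH ij; exists k.
  case: (unliftP ord_max j) => [k jk | j_max]; last by rewrite i_max j_max eqxx in ij.
  by rewrite capvC; apply: IH; rewrite 1?eq_sym //; exists k.
move=> kj; apply/eqP; rewrite -subv0; apply/subvP=> x.
rewrite memv_cap !pr_lineE {1}/pr_vec liftK memv0.
case/andP=> /vlineP[a ->] /vlineP[b] /rowP ab; move: kj ab.
rewrite /pr_vec; case: unliftP => [l -> | _].
  rewrite (inj_eq lift_inj) => kl /(_ k).
  by rewrite !mxE !eqxx (negPf kl) mulr1 mulr0 => ->; rewrite scale0r.
(* At a coordinate [l] other than [k] the multiple of the basis vector vanishes, which forces the
   multiple of the all-ones vector to be 0. *)
have [l lk] : exists l : 'I_n, l != k.
  have : (1 < #|'I_n|)%N by rewrite card_ord.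
  by case/card_gt1P=> l [m [_ _ lm]]; have [lk|] := eqVneq l k;
    [exists m; rewrite -lk eq_sym | exists l].
move=> _ ab; have := ab l; have := ab k; rewrite !mxE !eqxx (negPf lk) !mulr1 mulr0.
by move=> -> <-; rewrite scale0r.
Qed.

Lemma card_pr_line i : (0 < n)%N -> #|pr_line F i| = #|F|.
Proof.
by move=> n_gt0; rewrite card_vspace pr_lineE dim_vline pr_vec_neq0 // expn1.
Qed.

Lemma card_pr_line2 i j :
  (1 < n)%N -> i != j -> #|(pr_line F i + pr_line F j)%VS| = (#|F| ^ 2)%N.
Proof.
move=> n_gt1 ij; rewrite card_vspace dimv_disjoint_sum ?pr_line_disjoint //.
by rewrite !pr_lineE !dim_vline !pr_vec_neq0 // ltnW.
Qed.

Definition pr_lines := [seq pr_line F i | i : 'I_n.+1].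

Lemma sumv_pr_lines : (\sum_(U <- pr_lines) U = fullv)%VS.
Proof.
apply/vspaceP=> x; rewrite memvf.
rewrite big_image /=; have := pr_spanT x.
by rewrite /pr_span (eq_bigl xpredT) // => i; rewrite inE.
Qed.

End PhaseRotationLines.

(** * Evaluation at a 2-independent set and the final bound *)

Lemma quad_indicator_shift2 (F : finFieldType) (n t : nat) (S : {set 'rV[F]_n}) :
    (1 < n)%N -> kindependent (@pr_graph F n) 2 S ->
  let X := sum_avg (pr_lines F n) - (t%:Z)%:~R in
  quad (indicator S) (X * (X - 1)) =
    #|S|%:R * ((n%:R + 1) / #|F|%:R + (n%:R + 1) * n%:R / #|F|%:R ^+ 2
      - (2 * t%:R + 1) * ((n%:R + 1) / #|F|%:R) + t%:R * (t%:R + 1)).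
Proof.
move=> n_gt1 indepS X; pose T := sum_avg (pr_lines F n); set q : rat := #|F|%:R.
have line_val i : quad (indicator S) (avg_mx (pr_line F i)) = #|S|%:R / q.
  rewrite quad_avg_separated; first by rewrite card_pr_line // ltnW.
  (* A line is its own sum with itself, so the statement for two lines applies with [i = j]. *)
  rewrite -[pr_line F i]addvv.
  exact: kindep2_separated.
have line2_val i j :
    i != j -> quad (indicator S) (avg_mx (pr_line F i + pr_line F j)) =
      #|S|%:R / q ^+ 2.
  move=> ij; rewrite quad_avg_separated; first by rewrite card_pr_line2 // natrX.
  exact: kindep2_separated.
(* The identity is written [avg_mx 0] so that [quad_avg_separated] evaluates it too. *)
have -> : X * (X - 1) = T * T - T *+ (2 * t + 1) + avg_mx 0 *+ (t * (t + 1)).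
  by rewrite avg_mx0; apply: mulr_shift2.
have TE : T = \sum_i avg_mx (pr_line F i) by rewrite /T /sum_avg big_image.
have T_val : quad (indicator S) T = (n%:R + 1) * (#|S|%:R / q).
  rewrite TE quad_sum (eq_bigr _ (fun i _ => line_val i)) sumr_const card_ord.
  by rewrite -[LHS]mulr_natl -natr1.
have TT_val : quad (indicator S) (T * T) =
    (n%:R + 1) * (#|S|%:R / q + n%:R * (#|S|%:R / q ^+ 2)).
  rewrite TE mulr_suml quad_sum.
  transitivity (\sum_(i < n.+1) (#|S|%:R / q + n%:R * (#|S|%:R / q ^+ 2))); last first.
    by rewrite sumr_const card_ord -[LHS]mulr_natl -natr1.
  (* For each [i], the term [j = i] is [P_i] by idempotence; the other [n] terms project along
     planes with [q ^ 2] points. *)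
  apply: eq_bigr => i _; rewrite mulr_sumr quad_sum (bigD1 i) //=.
  rewrite avg_mxM addvv line_val; congr (_ + _).
  transitivity (\sum_(j < n.+1 | j != i) #|S|%:R / q ^+ 2).
    by apply: eq_bigr => j ji; rewrite avg_mxM line2_val // eq_sym.
  by rewrite sumr_const cardC1 card_ord [RHS]mulr_natl.
rewrite !quadD quadN !quadMn TT_val T_val quad_avg_separated; last first.
  by move=> x y _ _; rewrite memv0 subr_eq0 => /eqP.
rewrite card_vspace dimv0 expn0.
rewrite -[_ *+ (2 * t + 1)]mulr_natr -[_ *+ (t * (t + 1))]mulr_natr.
rewrite natrD !natrM natrD.
have q_neq0 : q != 0 by rewrite pnatr_eq0 -lt0n; apply/card_gt0P; exists 0.
by field.
Qed.

Theorem theorem43 (F : finFieldType) (n q : nat)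
    (hn : (2 <= n)%N) (hq : #|F| = q) (hq3 : (3 <= q)%N) :
  (kindep_number (@pr_graph F n) 2)%:R <=
    (q%:R ^+ (n - 2) *
      ((n%:R * (n%:R + 1)
        + (n %/ q)%N%:R * q%:R
          * (- 2%:R - 2%:R * n%:R + q%:R + (n %/ q)%N%:R * q%:R))
       / ((n%:R - (n %/ q)%N%:R) * (n%:R + 1 - (n %/ q)%N%:R))) : rat).
Proof.
set t := (n %/ q)%N; set B := (X in _ <= X).
have q_gt0 : 0 < q%:R :> rat by rewrite ltr0n; lia.
have t_lt_n : t%:R + 1 <= n%:R :> rat.
  by rewrite natr1 ler_nat /t; apply: ltn_Pdiv; lia.
have pos : 0 < (n%:R - t%:R) * (n%:R + 1 - t%:R) :> rat by nra.
have bound (S : {set 'rV[F]_n}) :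
    S != set0 -> kindependent (@pr_graph F n) 2 S -> #|S|%:R <= B.
  rewrite -card_gt0 -(ltr0n rat) => S_gt0 indepS.
  have := psd_sum_avg (pr_lines F n) t%:Z (indicator S).
  rewrite quadD quadN quadZ quad_indicator_shift2 // sumv_pr_lines quad_avg_fullv.
  rewrite size_image card_ord hq.
  have -> : q%:R ^+ n = q%:R ^+ (n - 2) * q%:R ^+ 2 :> rat by rewrite -exprD subnK.
  have -> : (((n.+1%:Z - t%:Z) * (n.+1%:Z - t%:Z - 1))%:~R : rat)
      = (n%:R - t%:R) * (n%:R + 1 - t%:R).
    by rewrite intrM !intrB -!pmulrn -natr1; ring.
  rewrite /B.
  have : 0 < q%:R ^+ (n - 2) :> rat by rewrite exprn_gt0.
  move: (q%:R ^+ (n - 2)) pos S_gt0 q_gt0 => Q.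
  move: (n%:R) (t%:R) (q%:R) (#|S|%:R) => x y z s.
  move=> D_gt0 s_gt0 z_gt0 Q_gt0.
  rewrite [Q * (_ / _)]mulrA ler_pdivlMr //.
  set lhs := (X in 0 <= X).
  (* The inequality is a positive factor times the numerator of the bound minus [s] times its
     denominator; positivity of the factor needs [S] nonempty. *)
  have -> : lhs = s / (Q * z ^+ 2) *
      (Q * (x * (x + 1) + y * z * (- 2%:R - 2%:R * x + z + y * z))
       - s * ((x - y) * (x + 1 - y))).
    by rewrite /lhs; field; rewrite ?gt_eqF ?mulf_neq0 ?gt_eqF.
  by rewrite pmulr_rge0 ?subr_ge0 // divr_gt0 // mulr_gt0 // exprn_gt0.
(* A singleton is 2-independent, so [1 <= B]; this covers the empty set and the initial value 0 of
   the maximum. *)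
have B_ge0 : 0 <= B.
  have := bound [set 0%R]; rewrite cards1 -card_gt0 cards1.
  move=> /(_ isT) le1B; apply: le_trans (ler01) (le1B _).
  apply/forall_inP=> x /set1P->; apply/forall_inP=> y /set1P->.
  by rewrite eqxx.
rewrite /kindep_number; elim/big_ind: _ => // [a b aB bB | S indepS].
  by case: (ssrnat.leqP a b).
by have [-> | S_neq0] := eqVneq S set0; [rewrite cards0 | apply: bound].
Qed.
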